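(* Let $a\neq0$ and suppose that $f$ has the MLR property, i.e. $f(x_1-\eta_1)f(x_2-\eta_2)\ge f(x_1-\eta_2)f(x_2-\eta_1)$ whenever $x_1<x_2$ and $\eta_1<\eta_2$. Let $\delta_\phi(\mathbf X)=X_{(2)}-\phi(U)$ be a location equivariant estimator of $\theta_{(2)}$ such that (i) $\phi(t)$ is increasing in $t$; (ii) $\lim_{t\to\infty}\phi(t)=b_0$, where $b_0=\frac1a\ln\left(2\int_{-\infty}^{\infty}e^{ax}f(x)F(x)\,dx\right)$; (iii) $\displaystyle \phi(t)\ge\frac1a\ln\left(\frac{\int_{-\infty}^{\infty}\int_0^t e^{az}f(z-u)f(z)\,du\,dz}{\int_{-\infty}^{\infty}\int_0^t f(z-u)f(z)\,du\,dz}\right)$ for all $t>0$. Then $\delta_\phi$ improves upon $\delta_{b_0}(\mathbf X)=X_{(2)}-b_0$ under the linex loss $W(\delta-\theta_{(2)})$ with $W(t)=e^{at}-at-1$, in the sense that $R(\boldsymbol\theta,\delta_\phi)\le R(\boldsymbol\theta,\delta_{b_0})$ for all $\boldsymbol\theta\in\mathbb{R}^2$.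
   Context: Setting: $f$ is a Lebesgue probability density on $\mathbb{R}$ with distribution function $F(x)=\int_{-\infty}^x f(t)\,dt$; $X_1,X_2$ are independent and $X_i$ has density $x\mapsto f(x-\theta_i)$, where $\boldsymbol\theta=(\theta_1,\theta_2)\in\mathbb{R}^2$ is unknown. Write $\theta_{(2)}=\max\{\theta_1,\theta_2\}$, $X_{(1)}=\min\{X_1,X_2\}$, $X_{(2)}=\max\{X_1,X_2\}$, $U=X_{(2)}-X_{(1)}$, $\mathbf X=(X_1,X_2)$, $\phi:[0,\infty)\to\mathbb{R}$. The risk of $\delta$ is $R(\boldsymbol\theta,\delta)=E_{\boldsymbol\theta}[W(\delta(\mathbf X)-\theta_{(2)})]$. Standing assumption: all integrals involving the loss are finite and differentiation under the integral sign is permissible. *)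

(* Defs.v *)
From HB Require Import structures.
From mathcomp Require Import all_boot all_order all_algebra.
From mathcomp Require Import all_classical all_reals all_analysis.
Set Implicit Arguments.
Unset Strict Implicit.
Unset Printing Implicit Defensive.
Import Order.TTheory GRing.Theory Num.Theory.
Import numFieldNormedType.Exports.
Local Open Scope classical_set_scope.
Local Open Scope ring_scope.

Definition is_density (R : realType) (f : R -> R) : Prop :=
  [/\ measurable_fun setT f, forall x, 0 <= f x &
      (\int[lebesgue_measure]_x (f x)%:E = 1)%E].

Definition distribution_function (R : realType) (f : R -> R) (x : R) : R :=
  \int[lebesgue_measure]_(t in `]-oo, x]) f t.

Definition MLR (R : realType) (f : R -> R) : Prop :=
  forall x1 x2 eta1 eta2 : R, x1 < x2 -> eta1 < eta2 ->
    f (x1 - eta2) * f (x2 - eta1) <= f (x1 - eta1) * f (x2 - eta2).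

Definition has_density (d : measure_display) (Omega : measurableType d)
    (R : realType) (P : probability Omega R) (X : {RV P >-> R})
    (g : R -> R) : Prop :=
  forall A : set R, measurable A ->
    (distribution P X A = \int[lebesgue_measure]_(x in A) (g x)%:E)%E.

Definition independent (d : measure_display) (Omega : measurableType d)
    (R : realType) (P : probability Omega R) (X Y : {RV P >-> R}) : Prop :=
  forall A B : set R, measurable A -> measurable B ->
    (P (X @^-1` A `&` Y @^-1` B) = P (X @^-1` A) * P (Y @^-1` B))%E.

(* [P theta] is the law on the sample space under the parameter [theta]; the
   observables [X1] and [X2] do not depend on [theta]. *)
Definition location_model (d : measure_display) (Omega : measurableType d)
    (R : realType) (f : R -> R) (P : R * R -> probability Omega R)
    (X1 X2 : {mfun Omega >-> R}) : Prop :=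
  forall theta : R * R,
    [/\ has_density (P := P theta) X1 (fun x => f (x - theta.1)),
        has_density (P := P theta) X2 (fun x => f (x - theta.2)) &
        independent (P := P theta) X1 X2].

Definition risk (d : measure_display) (Omega : measurableType d)
    (R : realType) (P : R * R -> probability Omega R)
    (X1 X2 : {mfun Omega >-> R}) (W : R -> R) (theta : R * R)
    (delta : R * R -> R) : \bar R :=
  'E_(P theta)[(fun w => W (delta (X1 w, X2 w)
                            - Num.max theta.1 theta.2))%R]%E.

Definition linex (R : realType) (a t : R) : R := expR (a * t) - a * t - 1.

(* Only the values of [phi] on [0, +oo) matter, since the spacing is
   nonnegative. *)
Definition delta_equiv (R : realType) (phi : R -> R) (x : R * R) : R :=
  Num.max x.1 x.2 - phi (Num.max x.1 x.2 - Num.min x.1 x.2).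

Definition delta_const (R : realType) (b : R) (x : R * R) : R :=
  Num.max x.1 x.2 - b.

Definition linex_b0 (R : realType) (a : R) (f : R -> R) : R :=
  a^-1 * ln (2 * \int[lebesgue_measure]_x
                   (expR (a * x) * f x * distribution_function f x)).

Definition linex_bound (R : realType) (a : R) (f : R -> R) (t : R) : R :=
  a^-1 * ln
    ((\int[lebesgue_measure]_z \int[lebesgue_measure]_(u in `[0, t])
        (expR (a * z) * f (z - u) * f z)) /
     (\int[lebesgue_measure]_z \int[lebesgue_measure]_(u in `[0, t])
        (f (z - u) * f z))).

(* Main.v *)
Require Import Defs.
From HB Require Import structures.
From mathcomp Require Import all_boot all_order all_algebra.
From mathcomp Require Import all_classical all_reals all_analysis.
From mathcomp Require Import ring lra measurable_realfun.
Import Order.TTheory GRing.Theory Num.Theory.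
Import numFieldNormedType.Exports.
Local Open Scope classical_set_scope.
Local Open Scope ring_scope.

(* With [Z = X_(2) - theta_(2)], the risk difference of [delta_b0] and
   [delta_phi] is the integral over [y < b0] of [a E[(1 - e^(a(Z - y))) 1(phi U <= y)]]
   (Tonelli).  As [phi] is increasing, [{phi U <= y}] is an increasing union of
   events [{U <= t}] with [phi t <= y], so it suffices to compare
   [E[e^(a(Z - y)); U <= t]] with [P(U <= t)] when [y] is at least the bound (iii),
   which says that the comparison holds for [theta_1 = theta_2].  The density of
   [Z] on [{U <= t}] for parameters at distance [s], divided by the one for
   [s = 0], is nonincreasing: MLR makes [f (x + s) / f x] nonincreasing, and this
   passes to the window masses [F x - F (x - t)] by the basic composition formula.
   The comparison then follows from Chebyshev's association inequality, which is
   another instance of that formula. *)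

(** * Composition formula for products of integrals *)

Lemma ge0_integral_prod_sym {R : realType} (u v : R -> R) :
  measurable_fun setT u -> measurable_fun setT v ->
  (forall x, 0 <= u x) -> (forall x, 0 <= v x) ->
  (\int[lebesgue_measure]_x \int[lebesgue_measure]_y (u x * v y + u y * v x)%:E =
   \int[lebesgue_measure]_x (u x)%:E * \int[lebesgue_measure]_x (v x)%:E +
   \int[lebesgue_measure]_x (u x)%:E * \int[lebesgue_measure]_x (v x)%:E)%E.
Proof.
move=> mu mv u0 v0.
have mE (w : R -> R) : measurable_fun setT w ->
    measurable_fun setT (fun x => (w x)%:E).
  by move=> mw; exact/measurable_EFinP.
have I0 (w : R -> R) : (forall x, 0 <= w x) ->
    (0 <= \int[lebesgue_measure]_x (w x)%:E)%E.
  by move=> w0; apply: integral_ge0 => x _; rewrite lee_fin.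
transitivity (\int[lebesgue_measure]_x
    ((u x)%:E * \int[lebesgue_measure]_y (v y)%:E +
     (v x)%:E * \int[lebesgue_measure]_y (u y)%:E))%E.
  apply: eq_integral => x _.
  under eq_integral do rewrite EFinD EFinM [X in (_ + X)%E]EFinM [X in (_ + X)%E]muleC.
  rewrite ge0_integralD//.
  - by rewrite !ge0_integralZl_EFin// => *; do ?[exact: mE|rewrite lee_fin].
  - by move=> y _; rewrite mule_ge0// lee_fin.
  - by apply: emeasurable_funM => //; exact: mE.
  - by move=> y _; rewrite mule_ge0// lee_fin.
  - by apply: emeasurable_funM => //; exact: mE.
rewrite ge0_integralD//.
- rewrite !ge0_integralZr//; do ?[exact: mE | exact: I0 | by move=> x _; rewrite lee_fin].
  by congr (_ + _)%E; rewrite muleC.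
- by move=> y _; rewrite mule_ge0// ?lee_fin// I0.
- by apply: emeasurable_funM => //; exact: mE.
- by move=> y _; rewrite mule_ge0// ?lee_fin// I0.
- by apply: emeasurable_funM => //; exact: mE.
Qed.

(** By the symmetrised double integral above, twice the right side minus twice the left side is
    formally the double integral of the product of the two 2 by 2 determinants. That product is
    invariant under swapping [x] and [y], so its sign for [x < y] decides. Since the integrals may
    be infinite, the expanded nonnegative terms are compared instead of integrating a difference. *)
Lemma basic_composition {R : realType} (p1 p2 q1 q2 : R -> R) :
  measurable_fun setT p1 -> measurable_fun setT p2 ->
  measurable_fun setT q1 -> measurable_fun setT q2 ->
  (forall x, 0 <= p1 x) -> (forall x, 0 <= p2 x) ->
  (forall x, 0 <= q1 x) -> (forall x, 0 <= q2 x) ->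
  (forall x y, x < y ->
    0 <= (p1 x * p2 y - p1 y * p2 x) * (q1 x * q2 y - q1 y * q2 x)) ->
  (\int[lebesgue_measure]_x (p1 x * q2 x)%:E *
   \int[lebesgue_measure]_x (p2 x * q1 x)%:E <=
   \int[lebesgue_measure]_x (p1 x * q1 x)%:E *
   \int[lebesgue_measure]_x (p2 x * q2 x)%:E)%E.
Proof.
move=> mp1 mp2 mq1 mq2 p10 p20 q10 q20 H.
have {}H x y : 0 <= (p1 x * p2 y - p1 y * p2 x) * (q1 x * q2 y - q1 y * q2 x).
  have [xy|yx|->] := ltgtP x y; first exact: H.
    by have := H y x yx; congr (_ <= _); ring.
  by rewrite subrr mul0r.
have ge0M (p q : R -> R) : (forall x, 0 <= p x) -> (forall x, 0 <= q x) ->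
  forall x, 0 <= p x * q x by move=> *; rewrite mulr_ge0.
have mM (p q : R -> R) : measurable_fun setT p -> measurable_fun setT q ->
  measurable_fun setT (fun x => p x * q x) by exact: measurable_funM.
have I0 (w : R -> R) : (forall x, 0 <= w x) ->
    (0 <= \int[lebesgue_measure]_x (w x)%:E)%E.
  by move=> w0; apply: integral_ge0 => x _; rewrite lee_fin.
set A := (X in (X <= _)%E); set B := (X in (_ <= X)%E).
have A0 : (0 <= A)%E by rewrite mule_ge0 ?I0//; exact: ge0M.
have B0 : (0 <= B)%E by rewrite mule_ge0 ?I0//; exact: ge0M.
(* Halving in the extended reals: [B < A] forces [B] to be finite, and then [B + B < A + A]. *)
suff : (A + A <= B + B)%E.
  rewrite leNgt => AB; rewrite leNgt; apply: contra AB => BA.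
  by rewrite lteD// ge0_fin_numE// (lt_le_trans BA)// leey.
rewrite /A /B -!ge0_integral_prod_sym; do ?[exact: mM | exact: ge0M].
have mI (u v : R -> R) : measurable_fun setT u -> measurable_fun setT v ->
    (forall x, 0 <= u x) -> (forall x, 0 <= v x) ->
    measurable_fun setT (fun x =>
      (\int[lebesgue_measure]_y (u x * v y + u y * v x)%:E)%E).
  move=> mu mv u0 v0.
  apply: (@measurable_fun_fubini_tonelli_F _ _ _ _ _ lebesgue_measure
    (fun z : R * R => (u z.1 * v z.2 + u z.2 * v z.1)%:E)).
    apply/measurable_EFinP; apply: measurable_funD; apply: measurable_funM;
      exact: measurableT_comp.
  by move=> z; rewrite lee_fin addr_ge0// mulr_ge0.
apply: ge0_le_integral => //.
- by move=> x _; apply: I0 => y; rewrite addr_ge0// mulr_ge0// mulr_ge0.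
- by apply: mI; do ?[exact: mM | exact: ge0M].
- by apply: mI; do ?[exact: mM | exact: ge0M].
- move=> x _; apply: ge0_le_integral => //.
  + by move=> y _; rewrite lee_fin addr_ge0// mulr_ge0// mulr_ge0.
  + apply/measurable_EFinP; apply: measurable_funD; apply: measurable_funM => //; exact: mM.
  + apply/measurable_EFinP; apply: measurable_funD; apply: measurable_funM => //; exact: mM.
  + by move=> y _; rewrite lee_fin; have := H x y; nra.
Qed.

(** * Changes of variable, densities and joint laws *)

Lemma ge0_integral_shift {R : realType} (c : R) (h : R -> \bar R) :
  measurable_fun setT h -> (forall x, 0 <= h x)%E ->
  (\int[lebesgue_measure]_x h (x + c)%R = \int[lebesgue_measure]_x h x)%E.
Proof.
move=> mh h0.
pose T : R -> measurableTypeR R := fun x => x + c.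
have mT : measurable_fun setT T by exact: measurable_funD.
rewrite -[LHS]/(\int[lebesgue_measure]_(x in T @^-1` setT) (h \o T) x)%E.
rewrite -ge0_integral_pushforward//.
apply: eq_measure_integral => A mA _ /=.
apply/esym/lebesgue_measure_unique => //= _ [[a b]] _ <-.
rewrite /pushforward [T @^-1` _](_ : _ = `]a - c, b - c]%classic).
  rewrite !lebesgue_measure_itv/= !lte_fin ltrD2r -!EFinB.
  by case: ifP => // _; congr (_%:E); ring.
by apply/seteqP; split => x /=; rewrite !in_itv/= /T ltrBlDr lerBrDr.
Qed.

Lemma ge0_integral_opp {R : realType} (h : R -> \bar R) :
  measurable_fun setT h -> (forall x, 0 <= h x)%E ->
  (\int[lebesgue_measure]_x h (- x)%R = \int[lebesgue_measure]_x h x)%E.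
Proof.
move=> mh h0.
pose T : R -> measurableTypeR R := -%R.
have mT : measurable_fun setT T by exact: measurable_funN.
rewrite -[LHS]/(\int[lebesgue_measure]_(x in T @^-1` setT) (h \o T) x)%E.
rewrite -ge0_integral_pushforward//.
by apply: eq_measure_integral => A mA _ /=; exact: lebesgue_measureN.
Qed.

Lemma ge0_integral_reflect {R : realType} (c : R) (h : R -> \bar R) :
  measurable_fun setT h -> (forall x, 0 <= h x)%E ->
  (\int[lebesgue_measure]_x h (c - x)%R = \int[lebesgue_measure]_x h x)%E.
Proof.
move=> mh h0; rewrite -(ge0_integral_shift c h)//.
rewrite -(ge0_integral_opp (fun x => h (x + c)%R))//.
  by apply: eq_integral => x _; rewrite addrC.
by apply: (measurableT_comp mh); exact: measurable_funD.
Qed.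

(** [nu] is dominated by [mu], and [g] agrees almost everywhere with the Radon-Nikodym derivative
    because both have the same integral over every measurable set. *)
Lemma ge0_integral_density {d} {T : measurableType d} {R : realType}
    (mu : {sigma_finite_measure set T -> \bar R}) (nu : probability T R)
    (g : T -> R) (h : T -> \bar R) :
  measurable_fun setT g -> (forall x, 0 <= g x) ->
  (forall A, measurable A -> nu A = \int[mu]_(x in A) (g x)%:E)%E ->
  measurable_fun setT h -> (forall x, 0 <= h x)%E ->
  (\int[nu]_x h x = \int[mu]_x (h x * (g x)%:E))%E.
Proof.
move=> mg g0 nuE mh h0.
have numu : nu `<< mu.
  apply/null_content_dominatesP => A mA A0; rewrite nuE//.
  by apply: null_set_integral => //; apply/measurable_funTS/measurable_EFinP.
rewrite -(@Radon_Nikodym_SigmaFinite.change_of_variables _ _ _ nu mu)//.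
apply: ae_eq_integral => //.
- apply: emeasurable_funM => //.
  exact: measurable_int (Radon_Nikodym_SigmaFinite.f_integrable numu).
- by apply: emeasurable_funM => //; exact/measurable_EFinP.
- apply: ae_eqe_mul2l; apply: integral_ae_eq => //.
  + exact: Radon_Nikodym_SigmaFinite.f_integrable.
  + exact/measurable_EFinP.
  + by move=> E _ mE; rewrite -nuE// (Radon_Nikodym_SigmaFinite.f_integral numu).
Qed.

(** Independence fixes the joint law on rectangles, hence identifies it with the product of the
    marginals. Tonelli then allows each marginal to be replaced by its density, one variable at a
    time. *)
Lemma ge0_integral_joint {d} {Omega : measurableType d} {R : realType}
    (P : probability Omega R) (X Y : {RV P >-> R}) (g1 g2 : R -> R)
    (h : R * R -> \bar R) :
  measurable_fun setT g1 -> (forall x, 0 <= g1 x) ->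
  measurable_fun setT g2 -> (forall x, 0 <= g2 x) ->
  has_density X g1 -> has_density Y g2 -> independent X Y ->
  measurable_fun setT h -> (forall x, 0 <= h x)%E ->
  (\int[P]_w h (X w, Y w) =
   \int[lebesgue_measure]_x \int[lebesgue_measure]_y
     (h (x, y) * (g1 x * g2 y)%:E))%E.
Proof.
move=> mg1 g10 mg2 g20 dX dY iXY mh h0.
have mX : measurable_fun setT (X : Omega -> measurableTypeR R) by exact: measurable_funPT X.
have mY : measurable_fun setT (Y : Omega -> measurableTypeR R) by exact: measurable_funPT Y.
pose X' : {mfun Omega >-> measurableTypeR R} :=
  HB.pack (X : Omega -> measurableTypeR R) (isMeasurableFun.Build _ _ _ _ _ mX).
pose Y' : {mfun Omega >-> measurableTypeR R} :=
  HB.pack (Y : Omega -> measurableTypeR R) (isMeasurableFun.Build _ _ _ _ _ mY).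
pose T : Omega -> measurableTypeR R * measurableTypeR R := fun w => (X' w, Y' w).
have mT : measurable_fun setT T by exact: measurable_fun_pair.
rewrite -[LHS]/(\int[P]_(w in T @^-1` setT) (h \o T) w)%E.
rewrite -ge0_integral_pushforward//.
transitivity (\int[distribution P X' \x distribution P Y']_z h z)%E.
  apply: eq_measure_integral => A mA _ /=.
  by apply/esym/product_measure_unique.
rewrite fubini_tonelli1//.
have mh2 x : measurable_fun setT (fun y : measurableTypeR R => h (x, y)).
  by apply: (measurableT_comp mh); exact: measurable_pair1.
transitivity (\int[distribution P X']_x \int[lebesgue_measure]_y (h (x, y) * (g2 y)%:E))%E.
  apply: eq_integral => x _; rewrite /fubini_F.
  exact: (ge0_integral_density lebesgue_measure (distribution P Y') g2).
have mF : measurable_fun setT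
    (fun x : measurableTypeR R => \int[lebesgue_measure]_y (h (x, y) * (g2 y)%:E))%E.
  apply: (@measurable_fun_fubini_tonelli_F _ _ _ _ _ lebesgue_measure
    (fun z : R * R => h z * (g2 z.2)%:E)%E).
    apply: emeasurable_funM => //; apply/measurable_EFinP.
    exact: measurableT_comp.
  by move=> z; rewrite mule_ge0// lee_fin.
rewrite (ge0_integral_density lebesgue_measure (distribution P X') g1)//; last first.
  by move=> x; apply: integral_ge0 => y _; rewrite mule_ge0// lee_fin.
apply: eq_integral => x _.
rewrite -ge0_integralZr//.
- apply: eq_integral => y _; rewrite -muleA; congr (_ * _)%E.
  by rewrite muleC EFinM.
- by apply: emeasurable_funM => //; exact/measurable_EFinP.
- by move=> y _; rewrite mule_ge0// lee_fin.
- by rewrite lee_fin.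
Qed.

(** * Window masses and the density of the maximum *)

Definition window_mass {R : realType} (f : R -> R) (t x : R) : R :=
  \int[lebesgue_measure]_(u in `[0, t]) f (x - u).

Lemma measurable_reflect {R : realType} (f : R -> R) (c : R) :
  measurable_fun setT f -> measurable_fun setT (fun x : R => f (c - x)).
Proof. by move=> mf; apply: (measurableT_comp mf); exact: measurable_funB. Qed.

Lemma measurable_shift {R : realType} (f : R -> R) (c : R) :
  measurable_fun setT f -> measurable_fun setT (fun x : R => f (x + c)).
Proof. by move=> mf; apply: (measurableT_comp mf); exact: measurable_funD. Qed.

Lemma window_mass_ge0 {R : realType} (f : R -> R) (t x : R) :
  (forall x, 0 <= f x) -> 0 <= window_mass f t x.
Proof. by move=> f0; apply: Rintegral_ge0. Qed.

(** The total mass 1 bounds the integral, so the [fine] hidden in the real-valued integral loses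
    nothing. *)
Lemma window_massE {R : realType} (f : R -> R) (t x : R) : is_density f ->
  ((window_mass f t x)%:E =
   \int[lebesgue_measure]_(u in `[0%R, t]) (f (x - u))%:E)%E.
Proof.
move=> [mf f0 f1]; rewrite /window_mass /Rintegral fineK// ge0_fin_numE//.
  apply: (@le_lt_trans _ _ (\int[lebesgue_measure]_u (f (x - u))%:E)%E).
    apply: ge0_subset_integral => //.
      by apply/measurable_EFinP; apply: measurable_reflect.
    by move=> u _; rewrite lee_fin.
  rewrite (ge0_integral_reflect x (fun y => (f y)%:E)) ?f1 ?ltry//.
  by apply/measurable_EFinP.
by apply: integral_ge0 => u _; rewrite lee_fin.
Qed.

Lemma window_mass_indicE {R : realType} (f : R -> R) (t x : R) : is_density f ->
  ((window_mass f t x)%:E =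
   \int[lebesgue_measure]_u (f (x - u) * \1_`[0%R, t] u)%:E)%E.
Proof.
move=> df; rewrite window_massE// integral_mkcond; apply: eq_integral => u _.
by rewrite epatch_indic EFinM.
Qed.

Lemma measurable_window_mass {R : realType} (f : R -> R) (t : R) : is_density f ->
  measurable_fun setT (window_mass f t).
Proof.
move=> df; have [mf f0 _] := df; apply/measurable_EFinP.
rewrite [X in measurable_fun _ X](_ : _ = fun x =>
    \int[lebesgue_measure]_u (f (x - u) * \1_`[0%R, t] u)%:E)%E; last first.
  by apply/funext => x; rewrite -window_mass_indicE.
apply: (@measurable_fun_fubini_tonelli_F _ _ _ _ _ lebesgue_measure
    (fun z : R * R => (f (z.1 - z.2) * \1_`[0%R, t] z.2)%:E)).
  apply/measurable_EFinP; apply: measurable_funM.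
    by apply: (measurableT_comp mf); exact: measurable_funB.
  by apply: measurableT_comp => //; exact: measurable_indic.
by move=> z; rewrite lee_fin mulr_ge0.
Qed.

(** This is MLR at the points [x + s] and [y + s] for the locations [0] and [s]: the ratio
    [f (x + s) / f x] is nonincreasing, with denominators cleared because [f] may vanish. *)
Lemma MLR_shift {R : realType} (f : R -> R) (s x y : R) : MLR f -> 0 <= s ->
  x < y -> f x * f (y + s) <= f y * f (x + s).
Proof.
move=> fMLR; rewrite le_eqVlt => /predU1P[<-|s0] xy.
  by rewrite !addr0 mulrC.
have := fMLR (x + s) (y + s) 0 s; rewrite ltrD2r !subr0 !addrK => /(_ xy s0).
by rewrite [X in _ <= X -> _]mulrC.
Qed.

(** A window mass is the convolution of [f] with the indicator of [[0, t]]. Both factors are totally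
    positive of order two as translation kernels, the first by MLR and the second because [[0, t]]
    is an interval, and the composition formula carries this over to the convolution. *)
Lemma window_mass_log_concave {R : realType} (f : R -> R) (t s x y : R) :
  is_density f -> MLR f -> 0 <= s -> x < y ->
  window_mass f t x * window_mass f t (y + s) <=
  window_mass f t y * window_mass f t (x + s).
Proof.
move=> df fMLR s0 xy; have [mf f0 _] := df.
(* Moving the shift by [s] from the kernel to the window lets all four masses use only the kernels
   [f (x + s - u)] and [f (y + s - u)]. *)
have shiftE z : ((window_mass f t z)%:E =
    \int[lebesgue_measure]_u (f (z + s - u) * \1_`[0%R, t] (u - s))%:E)%E.
  rewrite window_mass_indicE//.
  rewrite -[RHS](ge0_integral_shift s).
  - by apply: eq_integral => u _; rewrite addrK opprD addrACA subrr addr0.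
  - apply/measurable_EFinP; apply: measurable_funM; first by apply: measurable_reflect.
    by apply: (measurable_shift (\1_`[0%R, t])); exact: measurable_indic.
  - by move=> u; rewrite lee_fin mulr_ge0.
rewrite -lee_fin !EFinM (shiftE x) (shiftE y) !window_mass_indicE//.
rewrite [leRHS]muleC.
apply: (basic_composition (fun u => f (x + s - u)) (fun u => f (y + s - u))) => //.
- by apply: measurable_reflect.
- by apply: measurable_reflect.
- by apply: (measurable_shift (\1_`[0%R, t])); exact: measurable_indic.
move=> u v uv; apply: mulr_ge0; rewrite subr_ge0.
  by apply: fMLR; rewrite ?ltrD2r.
rewrite !indicE !mem_setE !in_itv/=.
rewrite -!natrM ler_nat !mulnb.
case: (boolP ((0 <= v <= t) && (0 <= u - s <= t))) => // H.
(* If [v] and [u - s] lie in [[0, t]], then [0 <= s <= u < v <= t], so the products of indicators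
   are ordered. *)
suff -> : (0 <= u <= t) && (0 <= v - s <= t) by [].
by move: H => /andP[/andP[v0 vt] /andP[us ust]]; repeat (apply/andP; split); lra.
Qed.

(* Density of [X_(2) - theta_(2)] on the event [{U <= t}] when the parameters
   are at distance [s]; at [s = 0] it is twice [f x * window_mass f t x]. *)
Definition max_density {R : realType} (f : R -> R) (t s x : R) : R :=
  f x * window_mass f t (x + s) + f (x + s) * window_mass f t x.

Lemma max_density_ge0 {R : realType} (f : R -> R) (t s x : R) :
  (forall x, 0 <= f x) -> 0 <= max_density f t s x.
Proof.
by move=> f0; rewrite addr_ge0// mulr_ge0// window_mass_ge0.
Qed.

Lemma measurable_max_density {R : realType} (f : R -> R) (t s : R) :
  is_density f -> measurable_fun setT (max_density f t s).
Proof.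
move=> df; have [mf _ _] := df.
apply: measurable_funD; apply: measurable_funM => //.
- by apply: measurable_shift; exact: measurable_window_mass.
- exact: measurable_shift.
- exact: measurable_window_mass.
Qed.

(** * Monotone ratio of densities and association inequalities *)

(** Dividing [max_density f t s x] by [f x * window_mass f t x] gives [window_mass f t (x + s) /
    window_mass f t x + f (x + s) / f x], a sum of two nonincreasing ratios. *)
Lemma max_density_ratio {R : realType} (f : R -> R) (t s x y : R) :
  is_density f -> MLR f -> 0 <= s -> x < y ->
  f x * window_mass f t x * max_density f t s y <=
  f y * window_mass f t y * max_density f t s x.
Proof.
move=> df fMLR s0 xy; have [mf f0 _] := df.
have G0 z : 0 <= window_mass f t z by exact: window_mass_ge0.
have H1 := ler_wpM2l (mulr_ge0 (f0 x) (f0 y)) (window_mass_log_concave f t s x y df fMLR s0 xy).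
have H2 := ler_wpM2l (mulr_ge0 (G0 x) (G0 y)) (MLR_shift f s x y fMLR s0 xy).
by rewrite /max_density; lra.
Qed.

(** Chebyshev's inequality: under the weight [f x * window_mass f t x], the nondecreasing [k] and
    the nonincreasing density ratio are negatively correlated. *)
Lemma tilted_max_density_le {R : realType} (f k : R -> R) (t s : R) :
  is_density f -> MLR f -> 0 <= s ->
  measurable_fun setT k -> (forall x, 0 <= k x) ->
  (forall x y, x < y -> k x <= k y) ->
  (\int[lebesgue_measure]_x (k x * max_density f t s x)%:E *
   \int[lebesgue_measure]_x (f x * window_mass f t x)%:E <=
   \int[lebesgue_measure]_x (k x * (f x * window_mass f t x))%:E *
   \int[lebesgue_measure]_x (max_density f t s x)%:E)%E.
Proof.
move=> df fMLR s0 mk k0 kle; have [mf f0 _] := df.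
under [X in (_ * X <= _)%E]eq_integral do rewrite -[_ * _]mul1r.
under [X in (_ <= _ * X)%E]eq_integral do rewrite -[max_density _ _ _ _]mul1r.
apply: (basic_composition k (cst 1) (fun x => f x * window_mass f t x)) => //.
- by apply: measurable_funM => //; exact: measurable_window_mass.
- exact: measurable_max_density.
- by move=> x; rewrite mulr_ge0// window_mass_ge0.
- by move=> x; exact: max_density_ge0.
- move=> x y xy; rewrite !mulr1 mulr_le0 ?subr_le0 ?kle//.
  exact: max_density_ratio.
Qed.

(** The mirror case, used for [a < 0]: a nonincreasing [k] is positively correlated with the
    ratio. *)
Lemma tilted_max_density_ge {R : realType} (f k : R -> R) (t s : R) :
  is_density f -> MLR f -> 0 <= s ->
  measurable_fun setT k -> (forall x, 0 <= k x) ->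
  (forall x y, x < y -> k y <= k x) ->
  (\int[lebesgue_measure]_x (max_density f t s x)%:E *
   \int[lebesgue_measure]_x (k x * (f x * window_mass f t x))%:E <=
   \int[lebesgue_measure]_x (f x * window_mass f t x)%:E *
   \int[lebesgue_measure]_x (k x * max_density f t s x)%:E)%E.
Proof.
move=> df fMLR s0 mk k0 kge; have [mf f0 _] := df.
under [X in (_ <= X * _)%E]eq_integral do rewrite -[_ * _]mul1r.
under [X in (X * _ <= _)%E]eq_integral do rewrite -[max_density _ _ _ _]mul1r.
apply: (basic_composition (cst 1) k (fun x => f x * window_mass f t x)) => //.
- by apply: measurable_funM => //; exact: measurable_window_mass.
- exact: measurable_max_density.
- by move=> x; rewrite mulr_ge0// window_mass_ge0.
- by move=> x; exact: max_density_ge0.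
- move=> x y xy; rewrite !mul1r mulr_le0 ?subr_le0 ?kge//.
  exact: max_density_ratio.
Qed.

(** * Law of the maximum on the event of a small spacing *)

(** The half-open window serves the ordering to which ties are not attributed; the removed point is
    Lebesgue-null. *)
Lemma window_mass_openE {R : realType} (f : R -> R) (t x : R) : is_density f ->
  ((window_mass f t x)%:E =
   \int[lebesgue_measure]_u (f (x - u) * \1_`]0%R, t] u)%:E)%E.
Proof.
move=> df; have [mf f0 _] := df.
rewrite window_massE// -integral_itv_obnd_cbnd; last first.
  by apply/measurable_EFinP/measurable_funTS; apply: measurable_reflect.
rewrite integral_mkcond; apply: eq_integral => u _.
by rewrite epatch_indic EFinM.
Qed.

(** The boolean [b] selects the left end of the window: closed for [true], open for [false]. *)
Lemma integral_window {R : realType} (f : R -> R) (x : R) (b : bool) (t : R) :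
  is_density f ->
  (\int[lebesgue_measure]_y (f y * \1_[set` Interval (BSide b 0%R) (BRight t)] (x - y))%:E
   = (window_mass f t x)%:E)%E.
Proof.
move=> df; have [mf f0 _] := df.
rewrite -(ge0_integral_reflect x).
- transitivity (\int[lebesgue_measure]_u
      (f (x - u) * \1_[set` Interval (BSide b 0%R) (BRight t)] u)%:E)%E.
    by apply: eq_integral => u _; rewrite subKr.
  by case: b; rewrite -?window_mass_indicE -?window_mass_openE.
- apply/measurable_EFinP/measurable_funM => //.
  by apply: (measurable_reflect (\1_ _)); exact: measurable_indic.
- by move=> y; rewrite lee_fin mulr_ge0.
Qed.

Lemma measurable_spacing {R : realType} :
  measurable_fun setT (fun z : R * R => Num.max z.1 z.2 - Num.min z.1 z.2).
Proof.
by apply: measurable_funB; [exact: measurable_maxr | exact: measurable_minr].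
Qed.

(** The integral splits according to which variable is the larger. When that one equals [x], the
    other must lie at most [t] below [x], which contributes its window mass at [x]. *)
Lemma ge0_integral_max_spacing {d} {Omega : measurableType d} {R : realType}
    (P : probability Omega R) (X Y : {RV P >-> R}) (g1 g2 k : R -> R) (t : R) :
  is_density g1 -> is_density g2 ->
  has_density X g1 -> has_density Y g2 -> independent X Y ->
  measurable_fun setT k -> (forall x, 0 <= k x) ->
  (\int[P]_w (k (Num.max (X w) (Y w)) *
     \1_`]-oo, t] (Num.max (X w) (Y w) - Num.min (X w) (Y w)))%:E =
   \int[lebesgue_measure]_x
     (k x * (g1 x * window_mass g2 t x + g2 x * window_mass g1 t x))%:E)%E.
Proof.
move=> dg1 dg2 dX dY iXY mk k0; have [mg1 g10 _] := dg1; have [mg2 g20 _] := dg2.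
have mI (B : set R) : measurable B -> measurable_fun setT (\1_B : R -> R).
  by move=> mB; exact: measurable_indic.
pose h (z : R * R) : \bar R := (k (Num.max z.1 z.2) *
  \1_`]-oo, t] (Num.max z.1 z.2 - Num.min z.1 z.2))%:E.
rewrite -[LHS]/(\int[P]_w h (X w, Y w))%E.
rewrite (ge0_integral_joint P X Y g1 g2)//; last first.
- by move=> z; rewrite lee_fin mulr_ge0.
- apply/measurable_EFinP; apply: measurable_funM.
    by apply: (measurableT_comp mk); exact: measurable_maxr.
  exact: (measurableT_comp (mI _ (measurable_itv _)) measurable_spacing).
pose A (g g' : R -> R) b (z : R * R) :=
  k z.1 * g z.1 * (g' z.2 * \1_[set` Interval (BSide b 0%R) (BRight t)] (z.1 - z.2)).
have A0 g g' b z : (forall x, 0 <= g x) -> (forall x, 0 <= g' x) -> (0%:E <= (A g g' b z)%:E)%E.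
  by move=> g_0 g'_0; rewrite lee_fin !mulr_ge0.
have mA g g' b : measurable_fun setT g -> measurable_fun setT g' ->
    measurable_fun setT (fun z => (A g g' b z)%:E).
  move=> mg mg'; apply/measurable_EFinP; apply: measurable_funM.
    by apply: measurable_funM; exact: measurableT_comp.
  apply: measurable_funM; first exact: measurableT_comp.
  by apply: (measurableT_comp (mI _ (measurable_itv _))); exact: measurable_funB.
have intA g g' b : is_density g -> is_density g' ->
    (\int[lebesgue_measure]_x \int[lebesgue_measure]_y (A g g' b (x, y))%:E =
     \int[lebesgue_measure]_x (k x * (g x * window_mass g' t x))%:E)%E.
  move=> [mg g_0 _] dg'; have [mg' g'0 _] := dg'.
  apply: eq_integral => x _; rewrite /A/=.
  under eq_integral do rewrite EFinM.
  rewrite ge0_integralZl_EFin//.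
  - by rewrite integral_window// -EFinM mulrA.
  - by move=> y _; rewrite lee_fin mulr_ge0.
  - apply/measurable_EFinP; apply: measurable_funM => //.
    by apply: (measurable_reflect (\1_ _)); exact: measurable_indic.
  - by rewrite mulr_ge0.
(* At each point at most one term is nonzero; ties belong to the first, whose window is closed at
   0. *)
transitivity (\int[lebesgue_measure]_x \int[lebesgue_measure]_y
    ((A g1 g2 true (x, y))%:E + (A g2 g1 false (y, x))%:E))%E.
  apply: eq_integral => x _; apply: eq_integral => y _.
  rewrite /h/A/= -EFinM -EFinD; congr (_%:E).
  rewrite !indicE !mem_setE !in_itv/= !subr_ge0 !subr_gt0.
  case: (leP y x) => xy /=.
    by rewrite !mulr0 addr0; ring.
  by rewrite !mulr0 add0r; ring.
transitivity (\int[lebesgue_measure]_x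
   (\int[lebesgue_measure]_y (A g1 g2 true (x, y))%:E +
    \int[lebesgue_measure]_y (A g2 g1 false (y, x))%:E))%E.
  apply: eq_integral => x _; rewrite ge0_integralD// => *; do ?exact: A0.
    by apply: (measurableT_comp (mA _ _ _ mg1 mg2)); exact: measurable_pair1.
  by apply: (measurableT_comp (mA _ _ _ mg2 mg1)); exact: measurable_pair2.
rewrite ge0_integralD//; last first.
- apply: (@measurable_fun_fubini_tonelli_G _ _ _ _ _ lebesgue_measure
    (fun z : R * R => (A g2 g1 false z)%:E)); first exact: mA.
  by move=> z; exact: A0.
- by move=> x _; apply: integral_ge0 => y _; exact: A0.
- apply: (@measurable_fun_fubini_tonelli_F _ _ _ _ _ lebesgue_measure
    (fun z : R * R => (A g1 g2 true z)%:E)); first exact: mA.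
  by move=> z; exact: A0.
- by move=> x _; apply: integral_ge0 => y _; exact: A0.
(* Exchanging the order of integration makes the larger variable the outer one in the second term as
   well. *)
have -> : (\int[lebesgue_measure]_x \int[lebesgue_measure]_y (A g2 g1 false (y, x))%:E =
    \int[lebesgue_measure]_x \int[lebesgue_measure]_y (A g2 g1 false (x, y))%:E)%E.
  apply/esym; apply: (@fubini_tonelli _ _ _ _ _ lebesgue_measure lebesgue_measure
    (fun z : R * R => (A g2 g1 false z)%:E)).
    exact: mA.
  by move=> z; exact: A0.
rewrite !intA// -ge0_integralD//.
- by apply: eq_integral => x _; rewrite -EFinD mulrDr.
- by move=> x _; rewrite lee_fin !mulr_ge0// window_mass_ge0.
- apply/measurable_EFinP; do 2 apply: measurable_funM => //.
  exact: measurable_window_mass.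
- by move=> x _; rewrite lee_fin !mulr_ge0// window_mass_ge0.
- apply/measurable_EFinP; do 2 apply: measurable_funM => //.
  exact: measurable_window_mass.
Qed.

Lemma is_density_shift {R : realType} (f : R -> R) (c : R) :
  is_density f -> is_density (fun x => f (x - c)).
Proof.
move=> [mf f0 f1]; split => //; first by apply: measurable_shift.
by rewrite (ge0_integral_shift (- c) (fun x => (f x)%:E))//; apply/measurable_EFinP.
Qed.

Lemma window_mass_shift {R : realType} (f : R -> R) (c t x : R) :
  window_mass (fun x => f (x - c)) t x = window_mass f t (x - c).
Proof. by apply: eq_Rintegral => u _; rewrite addrAC. Qed.

(** After recentring at the larger parameter, one density becomes [f] and the other becomes [f]
    shifted by the distance of the parameters. Hence only this distance enters. *)
Lemma ge0_expectation_spacing {d} {Omega : measurableType d} {R : realType}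
    (P : probability Omega R) (X Y : {RV P >-> R}) (f k : R -> R) (theta : R * R)
    (t : R) :
  is_density f ->
  has_density X (fun x => f (x - theta.1)) ->
  has_density Y (fun x => f (x - theta.2)) -> independent X Y ->
  measurable_fun setT k -> (forall x, 0 <= k x) ->
  (\int[P]_w (k (Num.max (X w) (Y w) - Num.max theta.1 theta.2) *
     \1_`]-oo, t] (Num.max (X w) (Y w) - Num.min (X w) (Y w)))%:E =
   \int[lebesgue_measure]_x
     (k x * max_density f t `|theta.1 - theta.2| x)%:E)%E.
Proof.
move=> df dX dY iXY mk k0; have [mf f0 _] := df.
set m := Num.max theta.1 theta.2.
rewrite (ge0_integral_max_spacing P X Y _ _ (fun x => k (x - m)) t
  (is_density_shift f theta.1 df) (is_density_shift f theta.2 df))//; last first.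
  by apply: measurable_shift.
rewrite -(ge0_integral_shift m).
- apply: eq_integral => x _; rewrite !window_mass_shift addrK /max_density.
  congr (k x * _)%:E; rewrite /m; case: (leP theta.1 theta.2) => h.
    by rewrite ler0_norm ?subr_le0// opprB addrK -!(addrA x) [RHS]addrC.
  by rewrite gtr0_norm ?subr_gt0// addrK -!(addrA x).
- apply/measurable_EFinP/measurable_funM; first by apply: measurable_shift.
  by apply: measurable_funD; apply: measurable_funM;
    do ?[exact: measurable_window_mass (is_density_shift _ _ df)];
    apply: measurable_shift.
- move=> x; rewrite lee_fin mulr_ge0// addr_ge0// mulr_ge0//; exact: window_mass_ge0.
Qed.

(** A zero integral would give [{U <= t}] probability zero. Two independent copies falling in the
    same interval of length [t] have spacing at most [t], so the squared probability of each such
    interval would vanish; countably many of them cover the line. *)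
Lemma self_window_mass_gt0 {d} {Omega : measurableType d} {R : realType}
    (P : probability Omega R) (X Y : {RV P >-> R}) (f : R -> R) (t : R) :
  is_density f -> has_density X f -> has_density Y f -> independent X Y ->
  0 < t ->
  (0 < \int[lebesgue_measure]_x (f x * window_mass f t x)%:E)%E.
Proof.
move=> df dX dY iXY t0; have [mf f0 f1] := df.
have W0 x : 0 <= f x * window_mass f t x by rewrite mulr_ge0// window_mass_ge0.
rewrite lt0e integral_ge0 ?andbT; last by move=> x _; rewrite lee_fin.
apply/eqP => p0.
have mU : measurable_fun setT (fun w => Num.max (X w) (Y w) - Num.min (X w) (Y w)).
  by apply: measurable_funB; [exact: measurable_maxr | exact: measurable_minr].
pose U w := Num.max (X w) (Y w) - Num.min (X w) (Y w).
have PU0 : P (U @^-1` `]-oo, t]) = 0%E.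
  rewrite -[X in P X]setIT -integral_indic//; last first.
    by rewrite -[X in measurable X]setTI; exact: mU.
  have := @ge0_expectation_spacing _ _ _ P X Y f (cst 1) (0, 0) t df.
  rewrite /= subrr normr0.
  have fE : (fun x => f (x - 0)) = f by apply/funext => x; rewrite subr0.
  rewrite fE => /(_ dX dY iXY (measurable_cst _) (fun=> ler01)).
  under eq_integral do rewrite mul1r.
  move=> ->; rewrite -[RHS]adde0 -p0 -ge0_integralD//.
  - by apply: eq_integral => x _; rewrite mul1r /max_density addr0 EFinD.
  - by move=> x _; rewrite lee_fin.
  - apply/measurable_EFinP; apply: measurable_funM => //; exact: measurable_window_mass.
  - by move=> x _; rewrite lee_fin.
  - apply/measurable_EFinP; apply: measurable_funM => //; exact: measurable_window_mass.
have PI0 c : P (X @^-1` `[c, c + t]) = 0%E.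
  have mI (Z : {RV P >-> R}) : measurable (Z @^-1` `[c, c + t]).
    by rewrite -[X in measurable X]setTI; exact: (measurable_funPT Z).
  have PXY : P (X @^-1` `[c, c + t]) = P (Y @^-1` `[c, c + t]).
    have := dX _ (measurable_itv `[c, c + t]%R).
    by rewrite -(dY _ (measurable_itv `[c, c + t]%R)).
  have : (P (X @^-1` `[c, (c + t)%R]) * P (Y @^-1` `[c, (c + t)%R]) <= 0)%E.
    rewrite -iXY ?measurable_itv// -PU0 le_measure ?inE//.
    - exact: measurableI.
    - by rewrite -[X in measurable X]setTI; exact: mU.
    - move=> w [] /=; rewrite /U !in_itv/= => /andP[? ?] /andP[? ?].
      by case: (leP (X w) (Y w)) => ?; lra.
  rewrite -PXY => h; apply/eqP; rewrite eq_le measure_ge0 andbT leNgt.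
  by apply/negP => h0; have := mule_gt0 h0 h0; rewrite ltNge h.
have : (P.-negligible setT).
  apply: (@negligibleS _ _ _ P (\bigcup_(n in setT)
     ((X @^-1` `[t *+ n, t *+ n + t]) `|` (X @^-1` `[- (t *+ n + t), - (t *+ n + t) + t])))).
    (* The index is the integer part of [|X w| / t]; the two families of intervals serve the two
       signs of [X w]. *)
    move=> w _; exists (Num.truncn (`|X w| / t)) => //=.
    have /andP[] := truncn_itv (divr_ge0 (normr_ge0 (X w)) (ltW t0)).
    rewrite ler_pdivlMr// ltr_pdivrMr// !mulr_natl mulrSr => h1 h2.
    have [x0|x0] := leP 0 (X w); [left|right]; rewrite in_itv/=; apply/andP.
      by move: h1 h2; rewrite ger0_norm// => ? ?; split; lra.
    by move: h1 h2; rewrite ltr0_norm// => ? ?; split; lra.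
  apply: negligible_bigcup => n; apply: negligibleU; apply/negligibleP; do ?exact: PI0.
    by rewrite -[X in measurable X]setTI; exact: (measurable_funPT X).
  by rewrite -[X in measurable X]setTI; exact: (measurable_funPT X).
move/(measure_negligible measurableT) => PT.
by have := probability_setT P; rewrite PT => /eqP; rewrite eq_sym onee_eq0.
Qed.

(** * From the bound (iii) to a comparison of tilted and plain masses *)

Lemma window_mass_le1 {R : realType} (f : R -> R) (t x : R) : is_density f ->
  window_mass f t x <= 1.
Proof.
move=> df; have [mf f0 f1] := df; rewrite -lee_fin window_massE//.
rewrite -[leRHS]f1 -(ge0_integral_reflect x (fun y => (f y)%:E)); last first.
- by move=> u; rewrite lee_fin.
- by apply/measurable_EFinP.
apply: ge0_subset_integral => //.
  by apply/measurable_EFinP; apply: measurable_reflect.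
by move=> u _; rewrite lee_fin.
Qed.

Lemma integral_window_scale {R : realType} (f : R -> R) (c e t x : R) :
  is_density f -> 0 <= c -> 0 <= e ->
  (\int[lebesgue_measure]_(u in `[0%R, t]) (c * f (x - u) * e)%:E =
   (c * (e * window_mass f t x))%:E)%E.
Proof.
move=> df c0 e0; have [mf f0 f1] := df.
under eq_integral do rewrite mulrAC EFinM.
rewrite ge0_integralZl_EFin//.
- by rewrite -window_massE// -EFinM mulrA.
- by move=> u _; rewrite lee_fin.
- by apply/measurable_EFinP/measurable_funTS; apply: measurable_reflect.
- by rewrite mulr_ge0.
Qed.

Lemma linex_boundE {R : realType} (a : R) (f : R -> R) (t : R) : is_density f ->
  linex_bound a f t = a^-1 * ln
    (fine (\int[lebesgue_measure]_x (expR (a * x) * (f x * window_mass f t x))%:E) /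
     fine (\int[lebesgue_measure]_x (f x * window_mass f t x)%:E)).
Proof.
move=> df; have [mf f0 f1] := df.
rewrite /linex_bound /Rintegral; congr (_ * ln (fine _ / fine _)).
  apply: eq_integral => x _.
  by rewrite integral_window_scale// expR_ge0.
apply: eq_integral => x _.
under eq_integral do rewrite -[f (_ - _)]mul1r.
by rewrite integral_window_scale// mul1r.
Qed.

(** Used to pass positivity from the plain integral to the exponentially weighted one: a positive
    weight does not change where the integrand vanishes. *)
Lemma integral_eq0_weight {R : realType} (k g : R -> R) :
  measurable_fun setT k -> measurable_fun setT g ->
  (forall x, 0 < k x) -> (forall x, 0 <= g x) ->
  (\int[lebesgue_measure]_x (k x * g x)%:E = 0)%E ->
  (\int[lebesgue_measure]_x (g x)%:E = 0)%E.
Proof.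
move=> mk mg k0 g0 kg0.
have g0E : (\int[lebesgue_measure]_x `|(g x)%:E| = 0)%E -> (\int[lebesgue_measure]_x (g x)%:E = 0)%E.
  by under eq_integral do rewrite gee0_abs ?lee_fin//.
apply: g0E; apply/ae_eq_integral_abs => //; first exact/measurable_EFinP.
have mkg : measurable_fun setT (fun x : measurableTypeR R => (k x * g x)%:E).
  by apply/measurable_EFinP; exact: measurable_funM.
have : (\int[lebesgue_measure]_x `|(k x * g x)%:E| = 0)%E.
  by under eq_integral do rewrite gee0_abs ?lee_fin ?mulr_ge0 ?(ltW (k0 _))//.
move=> /(ae_eq_integral_abs lebesgue_measure measurableT mkg) [N [mN N0 kgN]].
exists N; split => // x /= gx; apply: kgN => /= kgx; apply: gx => _.
move: (kgx I) => /eqP; rewrite eqe mulf_eq0 gt_eqF//= => /eqP gx0.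
by rewrite gx0.
Qed.

(** Let [p] and [k] be the plain and exponentially weighted integrals of [f x * window_mass f t x].
    The bound says [ln (k / p) / a <= y], that is [exp (- a y) k <= p] if [a > 0], and the reverse
    if [a < 0]. Association compares [tilted * p] with [exp (- a y) k * plain] in the same
    direction, and [p], finite and positive, cancels. *)
Lemma tilted_mass_le {R : realType} (a : R) (f : R -> R) (t s y : R) :
  is_density f -> MLR f -> 0 <= s ->
  (0 < \int[lebesgue_measure]_x (f x * window_mass f t x)%:E)%E ->
  (\int[lebesgue_measure]_x
     (expR (a * x) * (f x * window_mass f t x))%:E < +oo)%E ->
  linex_bound a f t <= y ->
  let tilted :=
    (\int[lebesgue_measure]_x (expR (a * (x - y)) * max_density f t s x)%:E)%E in
  let plain := (\int[lebesgue_measure]_x (1 * max_density f t s x)%:E)%E in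
  (0 < a -> (tilted <= plain)%E) /\ (a < 0 -> (plain <= tilted)%E).
Proof.
move=> df fMLR s0 p_gt0 k_lty; have [mf f0 f1] := df.
have mW : measurable_fun setT (window_mass f t) by exact: measurable_window_mass.
have W0 x : 0 <= f x * window_mass f t x by rewrite mulr_ge0// window_mass_ge0.
have mfW : measurable_fun setT (fun x => f x * window_mass f t x).
  exact: measurable_funM.
have mexp b : measurable_fun setT (fun x : R => expR (a * (x - b))).
  by apply: measurableT_comp => //; apply: measurable_funM => //; exact: measurable_funB.
have mexp0 : measurable_fun setT (fun x : R => expR (a * x)).
  by apply: measurableT_comp => //; apply: measurable_funM.
have p_lty : (\int[lebesgue_measure]_x (f x * window_mass f t x)%:E < +oo)%E.
  apply: (@le_lt_trans _ _ 1%E); last exact: ltry.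
  rewrite -f1; apply: ge0_le_integral => //.
  - by move=> x _; rewrite lee_fin.
  - exact/measurable_EFinP.
  - exact/measurable_EFinP.
  - by move=> x _; rewrite lee_fin ler_piMr// window_mass_le1.
have k_gt0 : (0 < \int[lebesgue_measure]_x
     (expR (a * x) * (f x * window_mass f t x))%:E)%E.
  rewrite lt0e integral_ge0 ?andbT; last by move=> x _; rewrite lee_fin mulr_ge0// expR_ge0.
  apply/eqP => /integral_eq0_weight kW0; move: p_gt0.
  by rewrite kW0 ?ltxx// => x; exact: expR_gt0.
have kyE : (\int[lebesgue_measure]_x
      (expR (a * (x - y)) * (f x * window_mass f t x))%:E =
    (expR (- (a * y)))%:E * \int[lebesgue_measure]_x
      (expR (a * x) * (f x * window_mass f t x))%:E)%E.
  rewrite -ge0_integralZl_EFin ?expR_ge0//.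
  - apply: eq_integral => x _; rewrite -EFinM (mulrA (expR _) (expR _)) -expRD.
    by congr (expR _ * _)%:E; ring.
  - by move=> x _; rewrite lee_fin mulr_ge0// expR_ge0.
  - by apply/measurable_EFinP; exact: measurable_funM.
rewrite linex_boundE//.
move: p_gt0 p_lty k_gt0 k_lty kyE.
set p := (\int[lebesgue_measure]_x (f x * window_mass f t x)%:E)%E.
set k := (\int[lebesgue_measure]_x (expR (a * x) * (f x * window_mass f t x))%:E)%E.
move=> p_gt0 p_lty k_gt0 k_lty kyE bound_y.
have p_fin : p \is a fin_num by rewrite ge0_fin_numE// ltW.
have k_fin : k \is a fin_num by rewrite ge0_fin_numE// ltW.
have fp_gt0 : 0 < fine p by rewrite fine_gt0// p_gt0.
have fk_gt0 : 0 < fine k by rewrite fine_gt0// k_gt0.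
have m_ge0 : (0 <= \int[lebesgue_measure]_x (1 * max_density f t s x)%:E)%E.
  by apply: integral_ge0 => x _; rewrite lee_fin mul1r max_density_ge0.
have mk_ge0 : (0 <= \int[lebesgue_measure]_x (expR (a * (x - y)) * max_density f t s x)%:E)%E.
  by apply: integral_ge0 => x _; rewrite lee_fin mulr_ge0 ?expR_ge0// max_density_ge0.
have one_mul : (\int[lebesgue_measure]_x (1 * max_density f t s x)%:E =
    \int[lebesgue_measure]_x (max_density f t s x)%:E)%E.
  by apply: eq_integral => x _; rewrite mul1r.
split=> [a_gt0|a_lt0].
- have ky_le : ((expR (- (a * y)))%:E * k <= p)%E.
    rewrite -(fineK k_fin) -(fineK p_fin) -EFinM lee_fin expRN mulrC.
    rewrite ler_pdivrMr ?expR_gt0// -ler_pdivrMl// mulrC.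
    rewrite -[leLHS]lnK ?posrE ?divr_gt0// ler_expR.
    by rewrite -ler_pdivrMl.
  rewrite -(lee_pmul2r p_fin p_gt0).
  apply: (@le_trans _ _ (_ * _)%E).
    apply: (tilted_max_density_le f (fun x => expR (a * (x - y))) t s) => //.
    by move=> x z xz; rewrite ler_expR ler_wpM2l ?ltW// ltrD2r.
  by rewrite kyE muleC one_mul lee_wpmul2l// -one_mul.
- have ky_ge : (p <= (expR (- (a * y)))%:E * k)%E.
    rewrite -(fineK k_fin) -(fineK p_fin) -EFinM lee_fin expRN mulrC.
    rewrite ler_pdivlMr ?expR_gt0// -ler_pdivlMl// [leRHS]mulrC.
    rewrite -[leRHS]lnK ?posrE ?divr_gt0// ler_expR.
    by rewrite -ler_ndivrMl.
  rewrite -(lee_pmul2l p_fin p_gt0) one_mul.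
  apply: le_trans; last first.
    apply: (tilted_max_density_ge f (fun x => expR (a * (x - y))) t s) => //.
    by move=> x z xz; rewrite ler_expR ler_wnM2l ?ltW// ltrD2r.
  by rewrite kyE muleC lee_wpmul2l// -one_mul.
Qed.

(** * Sublevel events and integration over layers *)

(** The set [S] of [s >= 0] with [phi s <= y] is, when nonempty, an interval starting at 0. It is
    bounded because [phi] exceeds [y] somewhere, but may or may not contain its supremum. In both
    cases a nondecreasing sequence in [S] exhausts it, and monotone convergence transfers the
    comparison. *)
Lemma le_integral_sublevel {d} {Omega : measurableType d} {R : realType}
    (mu : {measure set Omega -> \bar R}) (U : Omega -> R) (phi : R -> R) (y : R)
    (g1 g2 : Omega -> \bar R) :
  measurable_fun setT U -> (forall w, 0 <= U w) ->
  (forall s t : R, 0 <= s -> s <= t -> phi s <= phi t) ->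
  (exists2 t, 0 <= t & y < phi t) ->
  measurable_fun setT g1 -> (forall w, 0 <= g1 w)%E ->
  measurable_fun setT g2 -> (forall w, 0 <= g2 w)%E ->
  (forall s : R, 0 <= s -> phi s <= y ->
    (\int[mu]_(w in U @^-1` `]-oo, s]) g1 w <=
     \int[mu]_(w in U @^-1` `]-oo, s]) g2 w)%E) ->
  (\int[mu]_(w in [set w | (phi (U w) <= y)%R]) g1 w <=
   \int[mu]_(w in [set w | (phi (U w) <= y)%R]) g2 w)%E.
Proof.
move=> mU U0 phi_incr [b b0 yb] mg1 g10 mg2 g20 leg.
pose S : set R := [set s : R | 0 <= s /\ phi s <= y].
have [[s0 [s0_ge0 s0y]]|S0] := pselect (S !=set0); last first.
  have -> : [set w | phi (U w) <= y] = set0.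
    by apply/seteqP; split => // w /= h; apply: S0; exists (U w).
  by rewrite !integral_set0.
have Sb s : S s -> s < b.
  by move=> [s_ge0 sy]; rewrite ltNge; apply/negP => /(phi_incr _ _ b0); lra.
have hsS : has_sup S.
  by split; [exists s0 | exists b => s /Sb /ltW].
have Slt s : 0 <= s -> s < sup S -> S s.
  move=> s_ge0 sS; split => //.
  have [u [u_ge0 uy] su] := sup_gt (ex_intro _ s0 (conj s0_ge0 s0y) : S !=set0) sS.
  by apply: (le_trans _ uy); apply: phi_incr => //; exact: ltW.
have leS s : S s -> s <= sup S by move=> Ss; apply: sup_ubound => //; exact: hsS.2.
have [sq [sq_nd sqS sq_cov]] : exists sq : nat -> R,
    [/\ nondecreasing_seq sq, forall n, S (sq n) &
        forall u, S u -> exists n, u <= sq n].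
  have [SS|nSS] := pselect (S (sup S)).
    by exists (fun=> sup S); split => // u /leS us; exists 0%N.
  have Sgt0 : 0 < sup S.
    rewrite lt_neqAle (le_trans s0_ge0 (leS s0 _))// andbT.
    apply/negP => /eqP S_0; apply: nSS; suff <- : s0 = sup S by [].
    by apply/eqP; rewrite eq_le leS//= -S_0.
  (* When the supremum is not attained, these points stay nonnegative and strictly below it, hence
     in [S], and increase to it. *)
  exists (fun n => sup S - sup S / n.+1%:R); split.
  - move=> m n mn; rewrite lerD2l lerN2 ler_wpM2l ?(ltW Sgt0)//.
    by rewrite lef_pV2 ?posrE// ler_nat.
  - move=> n; apply: Slt.
      by rewrite subr_ge0 ler_pdivrMr// ler_peMr ?ler1n// ltW.
    by rewrite ltrBlDr ltrDl divr_gt0.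
  - move=> u Su; have uS : u < sup S.
      rewrite lt_neqAle leS// andbT; apply/negP => /eqP uE.
      by apply: nSS; rewrite -uE.
    (* With this [n], [n + 1] exceeds [sup S / (sup S - u)], which rearranges to
       [u <= sup S - sup S / (n + 1)]. *)
    exists (Num.truncn (sup S / (sup S - u))).
    rewrite lerBrDr -lerBrDl ler_pdivrMr// mulrC -ler_pdivrMr ?subr_gt0//.
    exact/ltW/truncnS_gt.
have subE : [set w | phi (U w) <= y] = \bigcup_n (U @^-1` `]-oo, sq n]).
  apply/seteqP; split => [w /= Uwy|w [n _]] /=.
    have [n Un] := sq_cov (U w) (conj (U0 w) Uwy).
    by exists n => //=; rewrite in_itv.
  rewrite in_itv/= => Un; apply: (le_trans _ (sqS n).2).
  exact: phi_incr.
have mF n : measurable (U @^-1` `]-oo, sq n]).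
  by rewrite -[X in measurable X]setTI; exact: mU.
have ndF : nondecreasing_seq (fun n => U @^-1` `]-oo, sq n]).
  move=> m n mn; apply/subsetPset => w /=; rewrite !in_itv/= => /le_trans; apply.
  exact: sq_nd.
have cvg_sq g : measurable_fun setT g -> (forall w, 0 <= g w)%E ->
    ((\int[mu]_(w in U @^-1` `]-oo, sq n]) g w)%E @[n --> \oo] -->
     (\int[mu]_(w in [set w | (phi (U w) <= y)%R]) g w)%E).
  move=> mg g0; rewrite subE; apply: ge0_nondecreasing_set_cvg_integral => //.
  by move=> n; exact: measurable_funTS.
have c1 := cvg_sq g1 mg1 g10; have c2 := cvg_sq g2 mg2 g20.
rewrite -(cvg_lim _ c1)// -(cvg_lim _ c2)//.
apply: lee_lim; [by apply/cvg_ex; eexists; exact: c1|by apply/cvg_ex; eexists; exact: c2|].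
by apply: nearW => n; apply: leg; [exact: (sqS n).1|exact: (sqS n).2].
Qed.

(** The two indicators encode [v <= y < b], in a form that is jointly measurable once [v] becomes
    random. The value comes from the antiderivative [- expR (a * (z - y)) / a] in [y]. *)
Lemma integral_expR_window {R : realType} (a z v b : R) : a != 0 -> v <= b ->
  (\int[lebesgue_measure]_y
     (expR (a * (z - y)) * (\1_`[0%R, +oo[ (y - v) * \1_`]-oo, b[ y))%:E =
   ((expR (a * (z - v)) - expR (a * (z - b))) / a)%:E)%E.
Proof.
move=> a0 vb.
have mE : measurable_fun setT (fun y : R => expR (a * (z - y))).
  by apply: measurableT_comp => //; apply: measurable_funM => //; exact: measurable_funB.
transitivity (\int[lebesgue_measure]_(y in `[v, b[) (expR (a * (z - y)))%:E)%E.
  rewrite [RHS]integral_mkcond; apply: eq_integral => y _.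
  rewrite epatch_indic EFinM; congr (_ * _%:E)%E.
  rewrite !indicE !mem_setE !in_itv/= andbT subr_ge0.
  by case: (v <= y); case: (y < b); rewrite ?mulr0 ?mul0r ?mulr1.
rewrite integral_itv_bndo_bndc; last first.
  exact/measurable_EFinP/measurable_funTS.
move: vb; rewrite le_eqVlt => /predU1P[->|vb].
  by rewrite set_itv1 integral_set1 subrr mul0r.
pose F (y : R) := - (expR (a * (z - y)) / a).
have dF (y : R) : is_derive y 1 F (expR (a * (z - y))).
  have dg : is_derive y 1 (fun y : R => a * (z - y)) (- a).
    have -> : (fun y : R => a * (z - y)) = (a \*: (cst z - id)).
      by apply/funext.
    by apply: is_derive_eq; rewrite sub0r -[LHS]/(a * -1) mulrN1.
  have dc := @is_derive1_comp R expR _ y _ _ (is_derive_expR _) dg.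
  have -> : F = (- a^-1) \*: (expR \o (fun y : R => a * (z - y))).
    by apply/funext => u; rewrite /F /= -[RHS]/(- a^-1 * _) mulNr mulrC.
  apply: is_derive_eq.
  by rewrite -[LHS]/(- a^-1 * (expR (a * (z - y)) * - a)) mulrN mulrNN mulrCA mulVf// mulr1.
have cF : continuous F.
  by move=> y; apply/differentiable_continuous/derivable1_diffP; exact: ex_derive.
have cE : continuous (fun y : R => expR (a * (z - y))).
  move=> y; apply: continuous_comp; last exact: continuous_expR.
  apply: cvgM; first exact: cvg_cst.
  by apply: cvgB; [exact: cvg_cst|exact: cvg_id].
rewrite (@continuous_FTC2 _ _ F)//.
- by rewrite -EFinB /F; congr (_%:E); lra.
- exact: continuous_subspaceT.
- split.
  + by move=> y _; exact: ex_derive.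
  + exact/cvg_at_right_filter/cF.
  + exact/cvg_at_left_filter/cF.
- by move=> y _; rewrite derive1E; exact: derive_val.
Qed.

Lemma linex_ge0 {R : realType} (a t : R) : 0 <= linex a t.
Proof. by rewrite /linex -addrA -opprD subr_ge0 addrC expR_ge1Dx. Qed.

Lemma measurable_linex {R : realType} (a : R) : measurable_fun setT (linex a).
Proof.
have ma : measurable_fun setT (fun t : R => a * t) by apply: measurable_funM.
by apply: measurable_funB => //; apply: measurable_funB => //; exact: measurableT_comp.
Qed.

Lemma window_mass0 {R : realType} (f : R -> R) (x : R) : window_mass f 0 x = 0.
Proof. by rewrite /window_mass set_itv1 Rintegral_set1. Qed.

Lemma integral_sublevel_indic {d} {Omega : measurableType d} {R : realType}
    (mu : {measure set Omega -> \bar R}) (U g : Omega -> R) (s : R) :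
  (\int[mu]_(w in U @^-1` `]-oo, s]) (g w)%:E =
   \int[mu]_w (g w * \1_`]-oo, s] (U w))%:E)%E.
Proof.
by rewrite integral_mkcond; apply: eq_integral => w _; rewrite epatch_indic EFinM.
Qed.

Lemma fubini_lebesgue {d} {Omega : measurableType d} {R : realType}
    (P : probability Omega R) (h : Omega * R -> R) :
  measurable_fun setT h -> (forall z, 0 <= h z) ->
  (\int[P]_w \int[lebesgue_measure]_y (h (w, y))%:E =
   \int[lebesgue_measure]_y \int[P]_w (h (w, y))%:E)%E.
Proof.
move=> mh h0.
apply: (@fubini_tonelli _ _ _ _ _ P lebesgue_measure (fun z => (h z)%:E)).
  exact/measurable_EFinP.
by move=> z; rewrite lee_fin.
Qed.

(** * Comparison of the risks *)

Theorem theorem3p5 (R : realType) (d : measure_display)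
    (Omega : measurableType d) (P : R * R -> probability Omega R)
    (X1 X2 : {mfun Omega >-> R}) (f phi : R -> R) (a : R)
    (f_density : is_density f)
    (model : location_model f P X1 X2)
    (risk_phi_fin : forall theta : R * R,
      (risk P X1 X2 (linex a) theta (delta_equiv phi) < +oo)%E)
    (risk_b0_fin : forall theta : R * R,
      (risk P X1 X2 (linex a) theta (delta_const (linex_b0 a f)) < +oo)%E)
    (b0_fin : (\int[lebesgue_measure]_x
      (expR (a * x) * f x * distribution_function f x)%:E < +oo)%E)
    (bound_fin : forall t : R, 0 < t ->
      (\int[lebesgue_measure]_z \int[lebesgue_measure]_(u in `[0%R, t])
        (expR (a * z) * f (z - u) * f z)%:E < +oo)%E)
    (a_neq0 : a != 0)
    (f_MLR : MLR f)
    (phi_incr : forall s t : R, 0 <= s -> s <= t -> phi s <= phi t)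
    (phi_lim : phi t @[t --> +oo] --> linex_b0 a f)
    (phi_bound : forall t : R, 0 < t -> linex_bound a f t <= phi t) :
  forall theta : R * R,
    (risk P X1 X2 (linex a) theta (delta_equiv phi) <=
     risk P X1 X2 (linex a) theta (delta_const (linex_b0 a f)))%E.
Proof.
move=> theta.
set b0 := linex_b0 a f in phi_lim *.
have [mf f0 f1] := f_density.
have [dX1 dX2 indep] := model theta.
set m := Num.max theta.1 theta.2.
pose U w := Num.max (X1 w) (X2 w) - Num.min (X1 w) (X2 w).
pose Z w := Num.max (X1 w) (X2 w) - m.
pose V w := phi (U w).
have U0 w : 0 <= U w by rewrite /U; case: (leP (X1 w) (X2 w)) => ?; lra.
have mU : measurable_fun setT U.
  by apply: measurable_funB; [exact: measurable_maxr | exact: measurable_minr].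
have mZ : measurable_fun setT Z.
  by apply: measurable_funB => //; exact: measurable_maxr.
have mV : measurable_fun setT V.
  (* [phi] is monotone on the nonnegative half-line only; precomposing with [Num.max t 0] makes it
     monotone, hence measurable, on the whole line and leaves [V] unchanged since [U >= 0]. *)
  have -> : V = (fun t => phi (Num.max t 0)) \o U.
    by apply/funext => w; rewrite /V/= max_l.
  apply: measurableT_comp => //; apply: nondecreasing_measurable => // s t st.
  apply: phi_incr; first by rewrite le_max lexx orbT.
  by rewrite ge_max !le_max st lexx orbT.
have phi_le t : 0 <= t -> phi t <= b0.
  move=> t_ge0; apply: (cvgr_to_ge phi_lim).
  apply: (filterS _ (nbhs_pinfty_ge (num_real t))) => s ts.
  exact: phi_incr.
have V_le w : V w <= b0 by exact: phi_le.
have phi_large y : y < b0 -> exists2 t, 0 <= t & y < phi t.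
  move=> yb.
  have /filterI : \forall t \near +oo, y < phi t by exact: (cvgr_gt _ phi_lim).
  move=> /(_ _ (nbhs_pinfty_ge (num_real 0))) /filter_ex [t [/= yt t_ge0]].
  by exists t.
have fE : (fun x => f (x - 0)) = f by apply/funext => x; rewrite subr0.
have p_gt0 t : 0 < t ->
    (0 < \int[lebesgue_measure]_x (f x * window_mass f t x)%:E)%E.
  (* At the parameter [(0, 0)] the model provides two independent variables of density [f]. *)
  have [dY1 dY2 indep0] := model (0, 0); rewrite /= fE in dY1 dY2.
  exact: (self_window_mass_gt0 (P (0, 0)) X1 X2).
have k_lty t : 0 < t -> (\int[lebesgue_measure]_x
    (expR (a * x) * (f x * window_mass f t x))%:E < +oo)%E.
  move=> t0; have := bound_fin t t0.
  by under eq_integral do rewrite integral_window_scale ?expR_ge0//.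
pose tilt s y := (\int[P theta]_w (expR (a * (Z w - y)) * \1_`]-oo, s] (U w))%:E)%E.
pose plain s := (\int[P theta]_w (1 * \1_`]-oo, s] (U w))%:E)%E.
have mexp y : measurable_fun setT (fun x : R => expR (a * (x - y))).
  by apply: measurableT_comp => //; apply: measurable_funM => //; exact: measurable_funB.
have tilt_le s y : 0 <= s -> phi s <= y ->
    (0 < a -> (tilt s y <= plain s)%E) /\ (a < 0 -> (plain s <= tilt s y)%E).
  move=> s0 sy; rewrite /tilt /plain.
  rewrite (ge0_expectation_spacing (P theta) X1 X2 f
    (fun x => expR (a * (x - y))) theta s)//.
  rewrite (ge0_expectation_spacing (P theta) X1 X2 f (cst 1) theta s)//.
  (* The bound (iii) is available for positive windows only; for [s = 0] the windows are null and
     both sides vanish. *)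
  have [->|s_neq0] := eqVneq s 0.
    have -> g : (\int[lebesgue_measure]_x
        (g x * max_density f 0 `|theta.1 - theta.2| x)%:E = 0)%E.
      apply: integral0_eq => x _.
      by rewrite /max_density !window_mass0 !mulr0 addr0 mulr0.
    have -> g : (\int[lebesgue_measure]_x
        (g x * max_density f 0 `|theta.1 - theta.2| x)%:E = 0)%E.
      apply: integral0_eq => x _.
      by rewrite /max_density !window_mass0 !mulr0 addr0 mulr0.
    by [].
  have s_gt0 : 0 < s by rewrite lt_neqAle eq_sym s_neq0.
  apply: tilted_mass_le => //.
  - exact: p_gt0.
  - exact: k_lty.
  - exact: (le_trans (phi_bound s s_gt0)).
have layer_le y : y < b0 ->
  (0 < a -> (\int[P theta]_(w in [set w | (V w <= y)%R]) (expR (a * (Z w - y)))%:E <=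
             \int[P theta]_(w in [set w | (V w <= y)%R]) (1%R)%:E)%E) /\
  (a < 0 -> (\int[P theta]_(w in [set w | (V w <= y)%R]) (1%R)%:E <=
             \int[P theta]_(w in [set w | (V w <= y)%R]) (expR (a * (Z w - y)))%:E)%E).
  move=> yb.
  have mexpZ : measurable_fun setT (fun w => (expR (a * (Z w - y)))%:E).
    by apply/measurable_EFinP; exact: (measurableT_comp (mexp y) mZ).
  split=> asgn.
  - apply: (le_integral_sublevel _ U phi) => //; first exact: phi_large.
    move=> s s0 sy; rewrite !integral_sublevel_indic.
    exact: (tilt_le s y s0 sy).1.
  - apply: (le_integral_sublevel _ U phi) => //; first exact: phi_large.
    move=> s s0 sy; rewrite !integral_sublevel_indic.
    exact: (tilt_le s y s0 sy).2.
(* [L w y] is the indicator of [V w <= y < b0]. Integrating [expR (a * (Z w - y))] and 1 against it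
   in [y] gives the integrands of [A] and [B], and the difference of the losses at [Z - V] and
   [Z - b0] is [a] times the difference of these integrands. *)
pose L w y : R := \1_`[0%R, +oo[ (y - V w) * \1_`]-oo, b0[ y.
pose A := (\int[P theta]_w ((expR (a * (Z w - V w)) - expR (a * (Z w - b0))) / a)%:E)%E.
pose B := (\int[P theta]_w (b0 - V w)%:E)%E.
have mI (D : set R) : measurable D -> measurable_fun setT (\1_D : R -> R).
  by move=> mD; exact: measurable_indic.
have mL : measurable_fun setT (fun z : Omega * R => L z.1 z.2).
  apply: measurable_funM.
    apply: (measurableT_comp (mI _ (measurable_itv _))).
    by apply: measurable_funB => //; exact: (measurableT_comp mV).
  exact: (measurableT_comp (mI _ (measurable_itv _))).
have L0 w y : 0 <= L w y by rewrite mulr_ge0.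
have mexpL : measurable_fun setT
    (fun z : Omega * R => expR (a * (Z z.1 - z.2)) * L z.1 z.2).
  apply: measurable_funM => //; apply: measurableT_comp => //.
  apply: measurable_funM => //; apply: measurable_funB => //.
  exact: (measurableT_comp mZ).
have m1L : measurable_fun setT (fun z : Omega * R => 1 * L z.1 z.2).
  exact: measurable_funM.
have AE : A = (\int[lebesgue_measure]_y \int[P theta]_w (expR (a * (Z w - y)) * L w y)%:E)%E.
  rewrite -(fubini_lebesgue (P theta) (fun z => expR (a * (Z z.1 - z.2)) * L z.1 z.2))//.
  - by rewrite /A; apply: eq_integral => w _ /=; rewrite /L integral_expR_window.
  - by move=> z; rewrite mulr_ge0 ?expR_ge0.
have BE : B = (\int[lebesgue_measure]_y \int[P theta]_w (1 * L w y)%:E)%E.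
  rewrite -(fubini_lebesgue (P theta) (fun z => 1 * L z.1 z.2))//.
  - rewrite /B; apply: eq_integral => w _ /=; rewrite /L.
    transitivity (\int[lebesgue_measure]_(y in `[V w, b0[) (cst 1%:E) y)%E.
      rewrite integral_cst//= lebesgue_measure_itv/= lte_fin mul1e.
      by case: ltP (V_le w) => // h1 h2; rewrite (le_anti (introT andP (conj h1 h2))) subrr.
    rewrite integral_mkcond; apply: eq_integral => y _.
    rewrite epatch_indic mul1e mul1r; congr (_%:E).
    rewrite !indicE !mem_setE !in_itv/= andbT subr_ge0.
    by case: (V w <= y); case: (y < b0); rewrite ?mulr0 ?mul0r ?mulr1.
  - by move=> z; rewrite mulr_ge0.
have layerE (g : Omega -> R) y : y < b0 ->
    (\int[P theta]_w (g w * L w y)%:E =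
     \int[P theta]_(w in [set w | (V w <= y)%R]) (g w)%:E)%E.
  move=> yb; rewrite [RHS]integral_mkcond; apply: eq_integral => w _.
  rewrite epatch_indic EFinM; congr (_ * _%:E)%E.
  rewrite /L !indicE !mem_setE !in_itv/= andbT subr_ge0 yb mulr1.
  by congr (_%:R); congr nat_of_bool; apply/esym/mem_setE.
have layer0 (g : Omega -> R) y : b0 <= y ->
    (\int[P theta]_w (g w * L w y)%:E = 0)%E.
  move=> yb; apply: integral0_eq => w _.
  by rewrite /L !indicE !mem_setE !in_itv/= [y < b0]ltNge yb !mulr0.
have mlayer (h : Omega * R -> R) : measurable_fun setT h -> (forall z, 0 <= h z) ->
    measurable_fun setT (fun y => \int[P theta]_w (h (w, y))%:E)%E.
  move=> mh h0; apply: (@measurable_fun_fubini_tonelli_G _ _ _ _ _ (P theta)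
    (fun z => (h z)%:E)); first exact/measurable_EFinP.
  by move=> z; rewrite lee_fin.
have mlayer_tilt := mlayer _ mexpL (fun z => mulr_ge0 (expR_ge0 _) (L0 z.1 z.2)).
have mlayer_plain := mlayer _ m1L (fun z => mulr_ge0 ler01 (L0 z.1 z.2)).
have layer_ge0 (g : Omega -> R) y : (forall w, 0 <= g w) ->
    (0 <= \int[P theta]_w (g w * L w y)%:E)%E.
  by move=> g0; apply: integral_ge0 => w _; rewrite lee_fin mulr_ge0.
have AB : (0 < a -> (A <= B)%E) /\ (a < 0 -> (B <= A)%E).
  rewrite AE BE; split=> asgn; apply: ge0_le_integral => //.
  - by move=> y _; apply: layer_ge0 => w; exact: expR_ge0.
  - move=> y _; have [yb|yb] := ltP y b0; last by rewrite !layer0.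
    by rewrite (layerE (cst 1))// layerE//; exact: (layer_le y yb).1.
  - by move=> y _; exact: (layer_ge0 (cst 1)).
  - move=> y _; have [yb|yb] := ltP y b0; last by rewrite !layer0.
    by rewrite (layerE (cst 1))// layerE//; exact: (layer_le y yb).2.
have riskE (D : Omega -> R) (delta : R * R -> R) :
    (forall w, delta (X1 w, X2 w) - m = D w) ->
    risk P X1 X2 (linex a) theta delta = (\int[P theta]_w (linex a (D w))%:E)%E.
  move=> DE; rewrite /risk unlock; apply: eq_integral => w _.
  by rewrite -DE.
rewrite (riskE (fun w => Z w - V w)); last first.
  by move=> w; rewrite /delta_equiv/= -/(U w) -/(V w) /Z; ring.
rewrite (riskE (fun w => Z w - b0)); last first.
  by move=> w; rewrite /delta_const/= /Z; ring.
have V_ge w : phi 0 <= V w by exact: phi_incr.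
have mA : measurable_fun setT
    (fun w => (expR (a * (Z w - V w)) - expR (a * (Z w - b0))) / a).
  apply: measurable_funM => //; apply: measurable_funB.
    apply: measurableT_comp => //; apply: measurable_funM => //.
    exact: measurable_funB.
  exact: (measurableT_comp (mexp b0) mZ).
have mB : measurable_fun setT (fun w => b0 - V w) by exact: measurable_funB.
have B0 w : 0 <= b0 - V w by rewrite subr_ge0.
have A0 w : 0 <= (expR (a * (Z w - V w)) - expR (a * (Z w - b0))) / a.
  have [a_gt0|a_lt0|a0] := ltgtP 0 a; last by rewrite -a0 eqxx in a_neq0.
    by rewrite divr_ge0 ?(ltW a_gt0)// subr_ge0 ler_expR ler_pM2l// lerD2l lerN2.
  rewrite -mulrNN -invrN divr_ge0 ?oppr_ge0 ?(ltW a_lt0)//.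
  by rewrite subr_le0 ler_expR ler_nM2l// lerD2l lerN2.
have B_fin : B \is a fin_num.
  rewrite ge0_fin_numE; last by apply: integral_ge0 => w _; rewrite lee_fin.
  (* Monotonicity gives [V >= phi 0], so the integrand of [B] is bounded by a constant. *)
  apply: (@le_lt_trans _ _ (\int[P theta]_w (cst (b0 - phi 0)%:E) w)%E).
    apply: ge0_le_integral => //.
    - by move=> w _; rewrite lee_fin.
    - exact/measurable_EFinP.
    - by move=> w _; rewrite lee_fin lerD2l lerN2.
  by rewrite integral_cst//= probability_setT mule1 ltry.
have mlinex D : measurable_fun setT D -> measurable_fun setT (fun w : Omega => linex a (D w)).
  by move=> mD; exact: (measurableT_comp (measurable_linex a)).
have mZV := mlinex _ (measurable_funB mZ mV).
have mZb := mlinex _ (measurable_funB mZ (measurable_cst b0)).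
have sumE (g h : Omega -> R) (c : R) : 0 <= c ->
    measurable_fun setT g -> measurable_fun setT h ->
    (forall w, 0 <= g w) -> (forall w, 0 <= h w) ->
    (\int[P theta]_w (g w)%:E + c%:E * \int[P theta]_w (h w)%:E =
     \int[P theta]_w (g w + c * h w)%:E)%E.
  move=> c0 mg mh g0 h0.
  rewrite -ge0_integralZl_EFin//; last 2 first.
  - by move=> w _; rewrite lee_fin.
  - exact/measurable_EFinP.
  rewrite -ge0_integralD//.
  - by move=> w _; rewrite lee_fin.
  - exact/measurable_EFinP.
  - by move=> w _; rewrite -EFinM lee_fin mulr_ge0.
  - by apply/measurable_EFinP; exact: measurable_funM.
have lg0 (D : Omega -> R) w : 0 <= linex a (D w) by exact: linex_ge0.
have [a_gt0|a_lt0|a0] := ltgtP 0 a; last by rewrite -a0 eqxx in a_neq0.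
- have aB_fin : (a%:E * B)%E \is a fin_num by rewrite fin_numM.
  (* Adding the finite [a * B] to both sides turns the loss identity into one between sums of
     nonnegative integrals, so no subtraction in the extended reals occurs; [A <= B] concludes. *)
  rewrite -(leeD2rE _ _ aB_fin).
  have -> : (\int[P theta]_w (linex a (Z w - V w))%:E + a%:E * B =
      \int[P theta]_w (linex a (Z w - b0))%:E + a%:E * A)%E.
    rewrite !sumE ?(ltW a_gt0)//; try by move=> w; exact: linex_ge0.
    apply: eq_integral => w _; congr (_%:E); rewrite /linex.
    by rewrite [a * (_ / a)]mulrC divfK//; ring.
  by apply: leeD2l; apply: lee_wpmul2l; [rewrite lee_fin ltW|exact: AB.1].
- have Na_ge0 : 0 <= - a by rewrite oppr_ge0 ltW.
  have aB_fin : ((- a)%:E * B)%E \is a fin_num by rewrite fin_numM.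
  (* For [a < 0] the coefficient [- a] keeps the terms nonnegative: [A] now accompanies the risk of
     [delta_equiv phi], and [B <= A] concludes. *)
  rewrite -(leeD2rE _ _ aB_fin).
  have <- : (\int[P theta]_w (linex a (Z w - V w))%:E + (- a)%:E * A =
      \int[P theta]_w (linex a (Z w - b0))%:E + (- a)%:E * B)%E.
    rewrite !sumE//; try by move=> w; exact: linex_ge0.
    apply: eq_integral => w _; congr (_%:E); rewrite /linex.
    by rewrite [- a * (_ / a)]mulNr [a * (_ / a)]mulrC divfK//; ring.
  by apply: leeD2l; apply: lee_wpmul2l; [rewrite lee_fin|exact: AB.2].
Qed.
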